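(* If $Y$ is the configuration $\{0000,1100,0011,1111\}$ in $Q_4$, then the $4$-cube density of $Y$ is $$\lambda(Y,4)=\frac{3}{8}.$$
   Context: The $n$-cube $Q_n$ is the graph with vertex set $V_n=\{0,1\}^n$, two vertices being adjacent iff they differ in exactly one coordinate. A configuration in $Q_n$ is a subset of $V_n$. For configurations $H,K$ in $Q_d$, $K$ is an exact copy of $H$ if some graph automorphism of $Q_d$ maps $H$ onto $K$. For $1\le d\le n$, a sub-$d$-cube $R$ of $Q_n$ is obtained by letting $d$ coordinates vary and fixing the other $n-d$ coordinates; there are $\binom{n}{d}2^{n-d}$ of them, and each is identified with $Q_d$ through its $d$ varying coordinates, so it makes sense to ask whether $S\cap R$ is an exact copy of $H$. For a configuration $H$ in $Q_d$ and $S\subseteq V_n$, let $g(H,d,n,S)$ be the number of sub-$d$-cubes $R$ of $Q_n$ such that $S\cap R$ is an exact copy of $H$, divided by $\binom{n}{d}2^{n-d}$. Let $\lambda(H,d,n)=\max_{S\subseteq V_n} g(H,d,n,S)$. This is nonincreasing in $n$, and the $d$-cube density of $H$ is $\lambda(H,d)=\lim_{n\to\infty}\lambda(H,d,n)$. *)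

(* Defs.v *)
From mathcomp Require Import all_boot all_order all_fingroup all_algebra.
From mathcomp Require Import classical_sets reals topology normedtype sequences.

Set Implicit Arguments.
Unset Strict Implicit.
Unset Printing Implicit Defensive.

Import Order.TTheory GRing.Theory Num.Theory.
Import numFieldNormedType.Exports.

Local Open Scope ring_scope.

Definition vertex (n : nat) := n.-tuple bool.

Definition configuration (n : nat) := {set vertex n}.

Definition cube_adjacent (n : nat) (u v : vertex n) : bool :=
  #|[set i : 'I_n | tnth u i != tnth v i]| == 1%N.

Definition cube_automorphism (n : nat) (s : {perm vertex n}) : bool :=
  [forall u, forall v, cube_adjacent (s u) (s v) == cube_adjacent u v].

Definition exact_copy (d : nat) (H K : configuration d) : bool :=
  [exists s : {perm vertex d}, cube_automorphism s && (s @: H == K)].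

(* A sub-d-cube of Q_n is coded by the set A of its varying coordinates and its
   vertex w that vanishes on A; thus w records exactly the values of the n - d
   fixed coordinates, and each subcube has a unique code (A, w). *)
Definition subcubes (d n : nat) : {set {set 'I_n} * vertex n} :=
  [set R : {set 'I_n} * vertex n |
    (#|R.1| == d) && [forall i in R.1, tnth R.2 i == false]].

(* The identification of Q_d with the subcube (A, w): the k-th coordinate of u
   becomes the k-th element of A in increasing order. The default value of nth
   is not reached when #|A| = d. *)
Definition subcube_embed (d n : nat) (R : {set 'I_n} * vertex n)
    (u : vertex d) : vertex n :=
  [tuple if i \in R.1 then nth false u (index i (enum R.1)) else tnth R.2 i
  | i < n].

(* S :&: R, read as a configuration in Q_d through subcube_embed. *)
Definition subcube_trace (d n : nat) (S : configuration n)
    (R : {set 'I_n} * vertex n) : configuration d :=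
  [set u : vertex d | subcube_embed R u \in S].

Definition copy_fraction (K : realType) (d n : nat) (H : configuration d)
    (S : configuration n) : K :=
  #|[set R in subcubes d n | exact_copy H (subcube_trace d S R)]|%:R
    / ('C(n, d) * 2 ^ (n - d))%:R.

(* The fractions are nonnegative, so the initial value 0 does not affect the
   maximum. For n < d there are no subcubes and the value is 0. *)
Definition max_copy_fraction (K : realType) (d : nat) (H : configuration d)
    (n : nat) : K :=
  \big[Num.max/0]_(S : configuration n) copy_fraction K H S.

(* The limit operator is total: its value is meaningful only together with
   cvgn (max_copy_fraction K H). *)
Definition cube_density (K : realType) (d : nat) (H : configuration d) : K :=
  limn (max_copy_fraction K H).

Definition Y : configuration 4 :=
  [set [tuple false; false; false; false];
       [tuple true;  true;  false; false];
       [tuple false; false; true;  true];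
       [tuple true;  true;  true;  true]].

(* Main.v *)
Require Import Defs.
From mathcomp Require Import all_boot all_order all_fingroup all_algebra.
From mathcomp Require Import zify ring lra.

(** Why the density is 3/8.

    A copy of [Y] in [Q_4] is cut out by two parity conditions
    [u_a + u_b = al] and [u_c + u_d = be], where [{a, b}] and [{c, d}] partition
    the four coordinates ([exact_copy_Y_parity]): an automorphism is an isometry,
    and [Y] consists of two points at distance 2 and of their antipodes.

    Lower bound.  Split the coordinates into two halves and let [S] be the set of
    vertices with an even number of ones in each half.  A subcube with two
    varying coordinates in each half meets [S] in a set given by two parity
    conditions, hence in a copy of [Y] ([balanced_exact_copy]).  The proportion of
    such subcubes is [C(h, 2) C(n - h, 2) / C(n, 4)], which is at least 3/8.

    Upper bound.  Each good subcube (one that meets [S] in a copy of [Y]) has 16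
    vertices, so it suffices to show that every vertex [x] of [Q_n], in [S] or
    not, lies in at most [n^4 / 64] good subcubes ([card_good_sets]); this is
    3/8 of [C(n, 4)] asymptotically.  Write [x^D] for [x] with the coordinates in
    [D] flipped, let [V] be the set of directions [i] with [x^{i}] outside [S], and
    join [i] to [j] when exactly one of [x] and [x^{i,j}] is in [S].  Expanding the
    parity conditions around [x], the four directions [A] of a good subcube
    through [x] are of one of two types ([good_cases]):
    - [A] lies in [V] and induces a 4-cycle;
    - two elements of [A] are outside [V] and the other two are a non-edge in [V].

    Let [m = #|V|] and [k = n - m], and let [d_v] be the degree of [v] in [V].
    A 4-cycle through an edge [ab] is completed by a neighbour of [b] not adjacent
    to [a] and a neighbour of [a] not adjacent to [b]; if there are [q] and [p]
    of these, then [p + q <= m], so [p q <= m (p + q) / 4].  Summing [p + q] over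
    the edges counts paths [abc] without the chord [ac], at most
    [\sum_v d_v (m - d_v)] of them.  This is [card_induced_C4s]; for [m = n] it gives
    the classical upper bound 3/8 for the inducibility of the 4-cycle.
    Adding the second type, the number of good subcubes at [x] is at most
    [\sum_(v in V) (m - d_v) (m d_v + 4 k^2) / 16], and every term is at most
    [n^4 / (64 m)] by the AM-GM inequality ([local_inequality]). *)

Set Implicit Arguments.
Unset Strict Implicit.
Unset Printing Implicit Defensive.

(** * Copies of [Y] in the 4-cube *)

Definition flip n (x : vertex n) (D : {set 'I_n}) : vertex n :=
  [tuple tnth x i (+) (i \in D) | i < n].

Lemma tnth_flip n (x : vertex n) D i : tnth (flip x D) i = tnth x i (+) (i \in D).
Proof. by rewrite tnth_mktuple. Qed.

Definition differ n (u v : vertex n) := [set i | tnth u i != tnth v i].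

Lemma card_differ_triangle n (u v w : vertex n) :
  #|differ u w| <= #|differ u v| + #|differ v w|.
Proof.
have sub : differ u w \subset differ u v :|: differ v w.
  apply/fintype.subsetP => i.
  by rewrite !inE -negb_and; apply: contra => /andP[/eqP-> /eqP->].
by apply: leq_trans (subset_leq_card sub) _; apply: leq_card_setU.
Qed.

(** A map that preserves adjacency is 1-Lipschitz for the Hamming distance: a
    path of shortest length is sent to a path of the same length. *)
Lemma adjacent_preserving_differ n (f : vertex n -> vertex n) (u v : vertex n) :
  (forall a b, cube_adjacent a b -> cube_adjacent (f a) (f b)) ->
  #|differ (f u) (f v)| <= #|differ u v|.
Proof.
move=> fP; move Ek: #|differ u v| => k; elim: k u Ek => [|k IHk] u Ek.
  suff -> : u = v.
    by rewrite leqn0 cards_eq0; apply/eqP/setP => i; rewrite !inE eqxx.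
  apply: eq_from_tnth => i; apply/eqP/negPn.
  by move/eqP: Ek; rewrite cards_eq0 => /eqP/setP/(_ i); rewrite !inE => ->.
have /card_gt0P[i iP] : 0 < #|differ u v| by rewrite Ek.
pose w := flip u [set i].
have uw : differ u w = [set i].
  apply/setP => j; rewrite !inE tnth_flip inE.
  by case: (tnth u j); case: (j == i).
have wv : #|differ w v| = k.
  have <- : differ u v :\ i = differ w v.
    apply/setP => j; rewrite !inE tnth_flip inE.
    case: eqVneq => [->|] /=; last by rewrite addbF.
    by move: iP; rewrite inE; case: (tnth u i); case: (tnth v i).
  by move: Ek; rewrite (cardsD1 i) iP => -[].
apply: leq_trans (card_differ_triangle _ (f w) _) _.
have /eqP-> : cube_adjacent (f u) (f w).
  by apply: fP; apply/eqP; rewrite -[RHS](cards1 i) -uw.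
by rewrite add1n ltnS; apply: IHk.
Qed.

Lemma automorphism_isometry n (s : {perm vertex n}) u v :
  cube_automorphism s -> #|differ (s u) (s v)| = #|differ u v|.
Proof.
move=> /forallP sP.
have sE a b : cube_adjacent (s a) (s b) = cube_adjacent a b.
  by have /forallP/(_ b)/eqP := sP a.
apply/eqP; rewrite eqn_leq adjacent_preserving_differ //=; last first.
  by move=> a b; rewrite sE.
rewrite -{1}(permK s u) -{1}(permK s v); apply: adjacent_preserving_differ => a b.
by rewrite -{1}(permKV s a) -{1}(permKV s b) sE.
Qed.

Lemma uniq4_cover (a b c d : 'I_4) : uniq [:: a; b; c; d] ->
  forall i, i \in [:: a; b; c; d].
Proof.
move=> Us i; have sub : {subset [:: a; b; c; d] <= enum 'I_4}.
  by move=> j _; rewrite mem_enum.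
have [|_ ->] := uniq_min_size Us sub; first by rewrite size_enum_ord.
by rewrite mem_enum.
Qed.

Lemma eq_vertex4 (a b c d : 'I_4) (u v : vertex 4) : uniq [:: a; b; c; d] ->
  (u == v) = [&& tnth u a == tnth v a, tnth u b == tnth v b,
                 tnth u c == tnth v c & tnth u d == tnth v d].
Proof.
move=> Us; apply/eqP/and4P => [-> //|[/eqP ua /eqP ub /eqP uc /eqP ud]].
apply: eq_from_tnth => i.
by have := uniq4_cover Us i; rewrite !inE => /or4P[] /eqP->.
Qed.

Lemma cards_setC4 (A : {set 'I_4}) : #|A| = 2 -> exists a b c d,
  uniq [:: a; b; c; d] /\ A = [set a; b].
Proof.
move=> A2; have CA2 : #|~: A| = 2 by move: (cardsC A); rewrite card_ord A2; lia.
have /eqP/cards2P[c [d [cd Ac]]] := CA2.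
have /eqP/cards2P[a [b [ab Aa]]] := A2.
exists a, b, c, d; split=> //=.
have cA j : j \in [set c; d] -> j \notin [set a; b] by rewrite -Ac -Aa inE.
move: (cA c) (cA d); rewrite !inE !eqxx !orbT /= => /(_ isT) + /(_ isT).
rewrite !negb_or !(eq_sym c) !(eq_sym d) => /andP[-> ->] /andP[-> ->].
by rewrite ab cd.
Qed.

(** The images of [0000] and [1100] differ in two coordinates [a] and [b], and the
    other two points are the antipodes of these images. *)
Lemma exact_copy_Y_parity (H : configuration 4) : exact_copy Y H ->
  exists a b c d : 'I_4, uniq [:: a; b; c; d] /\ exists al be : bool,
  forall u, (u \in H) =
    (tnth u a (+) tnth u b == al) && (tnth u c (+) tnth u d == be).
Proof.
case/existsP=> s /andP[sP /eqP <-] {H}.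
pose y0 : vertex 4 := [tuple false; false; false; false].
pose y1 : vertex 4 := [tuple true; true; false; false].
pose y2 : vertex 4 := [tuple false; false; true; true].
pose y3 : vertex 4 := [tuple true; true; true; true].
have dist u v : #|differ (s u) (s v)| = \sum_(i < 4) (tnth u i != tnth v i).
  rewrite automorphism_isometry // -sum1_card big_mkcond /=.
  by apply: eq_bigr => i _; rewrite inE; case: (_ != _).
have antipodal u v : #|differ (s u) (s v)| = 4 ->
    forall i, tnth (s v) i = ~~ tnth (s u) i.
  move=> d4 i; have : i \in differ (s u) (s v).
    suff -> : differ (s u) (s v) = setT by [].
    by apply/eqP; rewrite eqEcard subsetT d4 cardsT card_ord.
  by rewrite inE; case: (tnth _ i); case: (tnth _ i).
have d01 : #|differ (s y0) (s y1)| = 2.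
  by rewrite dist !big_ord_recl big_ord0 !(tnth_nth false).
have /antipodal e12 : #|differ (s y1) (s y2)| = 4.
  by rewrite dist !big_ord_recl big_ord0 !(tnth_nth false).
have /antipodal e03 : #|differ (s y0) (s y3)| = 4.
  by rewrite dist !big_ord_recl big_ord0 !(tnth_nth false).
have [a [b [c [d [Us Dab]]]]] := cards_setC4 d01.
have e01 i : tnth (s y1) i = tnth (s y0) i (+) (i \in [:: a; b]).
  have /setP/(_ i) := Dab; rewrite !inE.
  by case: (tnth _ i); case: (tnth _ i) => /= <-.
exists a, b, c, d; split=> //.
exists (tnth (s y0) a (+) tnth (s y0) b), (tnth (s y0) c (+) tnth (s y0) d) => u.
rewrite /Y !imsetU !imset_set1 !inE -/y0 -/y1 -/y2 -/y3.
rewrite !(eq_vertex4 _ _ Us) !e12 !e03 !e01 !inE !eqxx.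
move: Us; rewrite /= !inE !negb_or -!andbA => /and5P[ab ac ad bc].
rewrite !(eq_sym c) !(eq_sym d) (eq_sym b a).
rewrite (negPf ab) (negPf ac) (negPf ad) (negPf bc) => /and3P[/negPf-> _ _].
by case: (tnth u a); case: (tnth u b); case: (tnth u c); case: (tnth u d);
  case: (tnth _ a); case: (tnth _ b); case: (tnth _ c); case: (tnth _ d).
Qed.

(** * Incidences between vertices and subcubes *)

(** The second component of the code of the subcube through [x] in directions
    [A]. *)
Definition clear n (A : {set 'I_n}) (x : vertex n) : vertex n :=
  [tuple (i \notin A) && tnth x i | i < n].

Lemma mem_subcubes_clear d n (A : {set 'I_n}) x :
  ((A, clear A x) \in subcubes d n) = (#|A| == d).
Proof.
rewrite inE /= andb_idr // => _; apply/forallP => i; apply/implyP => iA.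
by rewrite tnth_mktuple iA.
Qed.

Lemma subcube_embed_coordinates d n (A : {set 'I_n}) (x y : vertex n)
    (e : d.-tuple 'I_n) :
  e = enum A :> seq _ -> (forall i, i \notin A -> tnth y i = tnth x i) ->
  subcube_embed (A, clear A x) (map_tuple (tnth y) e) = y.
Proof.
move=> eA yx; apply: eq_from_tnth => i; rewrite !tnth_mktuple /=.
have [iA|iA] := boolP (i \in A); last by rewrite yx.
have ie : i \in enum A by rewrite mem_enum.
by rewrite (nth_map i) eA ?nth_index // index_mem.
Qed.

Lemma tnth_subcube_embed d n (A : {set 'I_n}) (w : vertex n) (u : vertex d)
    (e : d.-tuple 'I_n) k :
  e = enum A :> seq _ -> tnth (subcube_embed (A, w) u) (tnth e k) = tnth u k.
Proof.
move=> eA; rewrite tnth_mktuple /=.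
have kA : tnth e k \in A by rewrite -mem_enum -eA; exact: mem_tnth.
rewrite kA -eA (tnth_nth (tnth e k)) index_uniq ?eA ?enum_uniq //.
  by rewrite (tnth_nth false).
by rewrite -eA size_tuple.
Qed.

Lemma card_subcube d n (R : {set 'I_n} * vertex n) : R \in subcubes d n ->
  #|[set x | clear R.1 x == R.2]| = 2 ^ d.
Proof.
case: R => A w; rewrite inE /= => /andP[/eqP Ad /'forall_implyP w0].
have eP : size (enum A) == d by rewrite -cardE Ad.
pose e := Tuple eP.
rewrite -[RHS](_ : #|{: vertex d}| = _); last by rewrite card_tuple card_bool.
rewrite -(@card_in_imset _ _ (fun x => map_tuple (tnth x) e)); last first.
  move=> x y; rewrite !inE => /eqP xw /eqP yw exy.
  rewrite -[x](@subcube_embed_coordinates d n A x x e) // exy.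
  rewrite xw -yw.
  by rewrite (@subcube_embed_coordinates d n A y y e).
rewrite -cardsT; congr #|pred_of_set _|; apply/setP => u; rewrite inE.
apply/imsetP; exists (subcube_embed (A, w) u).
  rewrite inE; apply/eqP/eq_from_tnth => i; rewrite !tnth_mktuple /=.
  by have [iA|iA] := boolP (i \in A) => //; rewrite (eqP (w0 i iA)).
by apply: eq_from_tnth => k; rewrite tnth_map tnth_subcube_embed.
Qed.

(** Double counting of the pairs of a vertex and a [d]-subcube through it, the
    subcube being named by its set of directions. *)
Lemma incidence_count d n (P : pred ({set 'I_n} * vertex n)) :
  \sum_(x : vertex n)
     #|[set A : {set 'I_n} | (#|A| == d) && P (A, clear A x)]| =
  2 ^ d * #|[set R in subcubes d n | P R]|.
Proof.
under eq_bigr => x _ do rewrite -sum1dep_card.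
rewrite pair_big_dep /=.
pose f (p : vertex n * {set 'I_n}) := (p.2, clear p.2 p.1).
rewrite (partition_big f (mem [set R in subcubes d n | P R])) /=; last first.
  by case=> x A /= /andP[Ad PA]; rewrite in_set mem_subcubes_clear Ad.
rewrite mulnC -sum_nat_const; apply: eq_bigr => -[A w] /[!inE] /andP[Rs PR].
rewrite -(card_subcube (R := (A, w))) ?inE // sum1dep_card.
rewrite -[RHS](@card_imset _ _ (fun x => (x, A))); last by move=> x y [].
apply: eq_card => -[x B]; rewrite !inE /f /=.
apply/andP/imsetP => [[/andP[Bd PB] /eqP[BA xw]]|[y]].
  by exists x; rewrite ?BA // inE -xw BA.
rewrite inE => /= /eqP yw [-> ->]; rewrite yw PR eqxx andbT.
by case/andP: Rs.
Qed.

(** The parity description of a copy of [Y], transported to the subcube and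
    centred at the vertex [x]: the bits of [x] are absorbed in the constants. *)
Lemma good_parity n (S : configuration n) (x : vertex n) (A : {set 'I_n}) :
  #|A| = 4 -> exact_copy Y (subcube_trace 4 S (A, clear A x)) ->
  exists a b c d, [/\ uniq [:: a; b; c; d], A = [set a; b; c; d] &
  exists al be, forall D : {set 'I_n}, D \subset A ->
    (flip x D \in S) = (((a \in D) (+) (b \in D)) == al) &&
                       (((c \in D) (+) (d \in D)) == be)].
Proof.
move=> A4 /exact_copy_Y_parity[a [b [c [d [Us [al [be cpP]]]]]]].
have eP : size (enum A) == 4 by rewrite -cardE A4.
pose e := Tuple eP.
have inj_e : injective (tnth e).
  by apply/tuple_uniqP; exact: enum_uniq.
exists (tnth e a), (tnth e b), (tnth e c), (tnth e d); split.
- by rewrite -(map_inj_uniq inj_e) in Us.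
- apply/setP => i; rewrite -mem_enum (_ : enum A = e) //.
  apply/tnthP/idP => [[k ->]|].
    by have := uniq4_cover Us k; rewrite !inE !(inj_eq inj_e) -!orbA.
  by rewrite !inE -!orbA => /or4P[] /eqP->; [exists a|exists b|exists c|exists d].
exists (al (+) tnth x (tnth e a) (+) tnth x (tnth e b)).
exists (be (+) tnth x (tnth e c) (+) tnth x (tnth e d)) => D DA.
have := cpP (map_tuple (tnth (flip x D)) e).
rewrite inE subcube_embed_coordinates // => [->|i]; last first.
  rewrite tnth_flip; case: (boolP (i \in D)) => [/(subsetP DA)->|_ _] //.
  by rewrite addbF.
have coord k : tnth (map_tuple (tnth (flip x D)) e) k =
    tnth x (tnth e k) (+) (tnth e k \in D) by rewrite tnth_map tnth_flip.
rewrite !coord.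
have par u1 u2 (v1 v2 ga : bool) :
    (u1 (+) v1 (+) (u2 (+) v2) == ga) = (v1 (+) v2 == ga (+) u1 (+) u2).
  by case: u1 u2 v1 v2 ga => [] [] [] [] [].
by rewrite !par.
Qed.

(** * Counting the two types of local configurations *)

Section LocalGraphCounts.
Variables (T : finType) (V : {set T}) (e : rel T).
Hypothesis e_sym : symmetric e.

Definition degree v := #|[set w in V | e v w]|.
Definition nondegree v := #|[set w in V | ~~ e v w]|.

(** Each induced 4-cycle occurs once for each of its eight cyclic orderings.
    Neither [a != c] nor [b != d] is imposed, so [(a, b, a, b)] also qualifies when
    [ab] is an edge between elements without loops; such tuples are within the
    bound below too. *)
Definition induced_C4s : {set T * T * T * T} :=
  [set t : T * T * T * T | let: (a, b, c, d) := t in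
   [&& [&& a \in V, b \in V, c \in V & d \in V],
       [&& e a b, e b c, e c d & e d a], ~~ e a c & ~~ e b d]].

Lemma degreeD v : degree v + nondegree v = #|V|.
Proof.
rewrite -(cardsID [set w | e v w] V); congr (_ + _); apply: eq_card => w;
  by rewrite !inE // andbC.
Qed.

Definition private_degree a b := #|[set c in V | e b c && ~~ e a c]|.

(** A tuple [(a, b, c, d)] consists of an edge [ab] and elements [c], [d] private to
    [b] and to [a].  The private sets are disjoint, so AM-GM bounds the product of
    their sizes by [#|V|] times the sum, over 4; summed over the edges, the sum
    counts twice the paths [abc] without the chord [ac], and these are among
    the pairs of a neighbour [b] and a non-neighbour [c] of [a]. *)
Lemma card_induced_C4s :
  2 * #|induced_C4s| <= #|V| * \sum_(v in V) degree v * nondegree v.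
Proof.
have C4le : #|induced_C4s| <=
    \sum_(a in V) \sum_(b in V | e a b) private_degree a b * private_degree b a.
  rewrite pair_big_dep /=.
  pose f (t : T * T * T * T) := let: (a, b, c, d) := t in (a, b).
  pose edge (ab : T * T) := [&& ab.1 \in V, ab.2 \in V & e ab.1 ab.2].
  rewrite -sum1_card (partition_big f edge) /=; last first.
    case=> [[[a b] c] d]; rewrite inE /edge /=.
    by case/and4P => /and4P[-> -> _ _] /and4P[-> _ _ _].
  apply: leq_sum => -[a b] /= abP; rewrite sum1_card /private_degree -cardsX.
  pose g (t : T * T * T * T) := let: (a, b, c, d) := t in (c, d).
  rewrite -(@card_in_imset _ _ g); last first.
    move=> [[[a1 b1] c1] d1] [[[a2 b2] c2] d2]; rewrite !unfold_in /=.
    by move=> /andP[_ /eqP[-> ->]] /andP[_ /eqP[-> ->]] [-> ->].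
  apply/subset_leq_card/subsetP => cd /imsetP[[[[a1 b1] c1] d1]].
  rewrite unfold_in /= !inE /=.
  case/andP => /and4P[/and4P[_ _ cV dV] /and4P[_ bc _ da] ac bd].
  move=> /eqP[aE bE] ->.
  by subst a1 b1; rewrite /= cV dV bc ac bd e_sym da.
have pV a b : private_degree a b + private_degree b a <= #|V|.
  rewrite /private_degree -cardsUI [X in _ + #|pred_of_set X|](_ : _ = set0) ?cards0 ?addn0.
    by apply/subset_leq_card/subsetP => c; rewrite !inE => /orP[]/andP[].
  by apply/setP => c; rewrite !inE; case: (c \in V) => //=; case: (e a c); case: (e b c).
have sumE : \sum_(a in V) \sum_(b in V | e a b) private_degree b a =
            \sum_(a in V) \sum_(b in V | e a b) private_degree a b.
  rewrite (exchange_big_dep (mem V)) /=; last by move=> a b _ /andP[].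
  apply: eq_bigr => b bV; apply: eq_big => a; first by rewrite bV /= e_sym.
  by [].
have cherry : \sum_(a in V) \sum_(b in V | e a b) private_degree a b <=
    \sum_(v in V) degree v * nondegree v.
  apply: leq_sum => a aV.
  rewrite /degree -sum1dep_card big_distrl /=.
  apply: leq_sum => b _; rewrite mul1n.
  by apply/subset_leq_card/subsetP => c; rewrite !inE => /and3P[-> _ ->].
have amgm : 4 * (\sum_(a in V) \sum_(b in V | e a b) private_degree a b * private_degree b a) <=
   #|V| * (\sum_(a in V) \sum_(b in V | e a b) (private_degree a b + private_degree b a)).
  rewrite !big_distrr /=; apply: leq_sum => a _; rewrite !big_distrr /=.
  apply: leq_sum => b _; have := pV a b.
  move: (private_degree a b) (private_degree b a) #|V| => p q m pqm.
  apply: (@leq_trans ((p + q) * (p + q))); last by rewrite leq_mul2r pqm orbT.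
  by have [le4 _] := nat_AGM2 p q; rewrite mulnn.
have : \sum_(a in V) \sum_(b in V | e a b) (private_degree a b + private_degree b a) =
   2 * \sum_(a in V) \sum_(b in V | e a b) private_degree a b.
  rewrite mul2n -addnn -[X in _ = _ + X]sumE -big_split /=.
  by apply: eq_bigr => a _; rewrite big_split.
by nia.
Qed.

Definition mixed_pairs : {set T * T * T * T} :=
  [set t : T * T * T * T | let: (a, b, c, d) := t in
   [&& a \notin V, b \notin V, c \in V, d \in V & ~~ e c d]].

Lemma card_mixed_pairs :
  #|mixed_pairs| = #|~: V| * #|~: V| * \sum_(v in V) nondegree v.
Proof.
have -> : \sum_(v in V) nondegree v =
    #|[set p : T * T | [&& p.1 \in V, p.2 \in V & ~~ e p.1 p.2]]|.
  under eq_bigr => v _ do rewrite /nondegree -sum1dep_card.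
  by rewrite pair_big_dep sum1dep_card.
rewrite -!cardsX.
pose f (t : T * T * T * T) := let: (a, b, c, d) := t in ((a, b), (c, d)).
rewrite -(@card_imset _ _ f); last by move=> [[[? ?] ?] ?] [[[? ?] ?] ?] [-> -> -> ->].
apply: eq_card => -[[a b] [c d]]; rewrite !inE /=.
apply/imsetP/idP => [[[[[a1 b1] c1] d1]]|H].
  by rewrite !inE => /and5P[aV bV cV dV cd] [-> -> -> ->]; rewrite aV bV cV dV.
  by exists (a, b, c, d) => //; rewrite !inE; move: H; rewrite -?andbA.
Qed.

End LocalGraphCounts.

(** AM-GM applied to [m (m - d)] and [m d + 4 k^2], whose sum is [m^2 + 4 k^2], is
    enough when [k] is small.  When [m < 2 k] that sum may exceed [(m + k)^2], but
    then the left-hand side decreases with [d], and AM-GM applies to its value [16 m^2 k^2]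
    at [d = 0]. *)
Lemma local_inequality m k d : d <= m ->
  4 * m * (m - d) * (m * d + 4 * k ^ 2) <= (m + k) ^ 4.
Proof.
move=> dm; have [km|km] := leqP (2 * k) m.
  have h : 4 * (m * (m - d)) * (m * d + 4 * k ^ 2) <= (m ^ 2 + 4 * k ^ 2) ^ 2.
    have -> : m ^ 2 + 4 * k ^ 2 = m * (m - d) + (m * d + 4 * k ^ 2).
      by rewrite addnA -mulnDr subnK // mulnn.
    by rewrite -mulnA; have [] := nat_AGM2 (m * (m - d)) (m * d + 4 * k ^ 2).
  have sq : m ^ 2 + 4 * k ^ 2 <= (m + k) ^ 2.
    by have := leq_mul (leqnn k) km; rewrite -!mulnn; nia.
  apply: leq_trans (_ : (m ^ 2 + 4 * k ^ 2) ^ 2 <= _).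
    by apply: leq_trans h; rewrite !mulnA.
  by rewrite (expnM _ 2 2) leq_exp2r.
have h : (m - d) * (m * d + 4 * k ^ 2) <= m * (4 * k ^ 2).
  have [r mE] : exists r, m = d + r by exists (m - d); rewrite subnKC.
  have h : d + r <= 2 * k by rewrite -mE ltnW.
  rewrite mE addKn -!mulnn.
  (* After cancellation the claim is [d * (r * (d + r)) <= d * (4 * k ^ 2)]. *)
  have rd : r * (d + r) <= 4 * (k * k) by have := leq_mul h h; nia.
  by have := leq_mul (leqnn d) rd; nia.
apply: leq_trans (_ : 4 * m * (m * (4 * k ^ 2)) <= _).
  by rewrite -mulnA leq_mul2l h orbT.
have [q _] := nat_AGM2 m k.
have -> : (m + k) ^ 4 = ((m + k) ^ 2) ^ 2 by rewrite -expnM.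
rewrite -!mulnn in q *; have := leq_mul q q; nia.
Qed.

(** * The directions of the good subcubes through a vertex *)

Section LocalStructure.
Variables (n : nat) (S : configuration n) (x : vertex n).

Definition non_neighbours := [set i | flip x [set i] \notin S].

(** Adding [x \in S] complements the relation when [x] is in [S], where the four
    directions of a good subcube would otherwise induce a perfect matching. *)
Definition local_graph : rel 'I_n := fun i j =>
  (flip x [set i; j] \in S) (+) (x \in S).

Lemma local_graph_sym : symmetric local_graph.
Proof. by move=> i j; rewrite /local_graph setUC. Qed.

Definition good_sets :=
  [set A : {set 'I_n} |
    (#|A| == 4) && exact_copy Y (subcube_trace 4 S (A, clear A x))].

(** With the constants [al], [be] of the parity conditions centred at [x]: if they
    are equal, then no [x^{i}] is in [S] and the pairs joined are those with one
    element in [{a, b}] and one in [{c, d}], a 4-cycle.  If [al] holds and [be] does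
    not, then [x^{a}] and [x^{b}] are in [S], [x^{c}] and [x^{d}] are not, and [cd]
    is a non-edge; the remaining case is symmetric. *)
Lemma good_cases A : A \in good_sets -> exists a b c d,
  [/\ uniq [:: a; b; c; d], A = [set a; b; c; d] &
  (a, b, c, d) \in induced_C4s non_neighbours local_graph :|:
                   mixed_pairs non_neighbours local_graph].
Proof.
rewrite inE => /andP[/eqP A4 /(good_parity A4)[a [b [c [d [Us AE [al [be par]]]]]]]].
have flip0 : flip x set0 = x by apply: eq_from_tnth => i; rewrite tnth_flip inE addbF.
have x_in : (x \in S) = (~~ al) && ~~ be.
  by rewrite -{1}flip0 par ?sub0set // !inE; case: (al); case: (be).
have par1 i : i \in A -> (flip x [set i] \in S) =
    (((a == i) (+) (b == i)) == al) && (((c == i) (+) (d == i)) == be).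
  by move=> iA; rewrite par ?sub1set // !inE.
have par2 i j : i \in A -> j \in A -> local_graph i j =
    (((((a == i) || (a == j)) (+) ((b == i) || (b == j))) == al) &&
    ((((c == i) || (c == j)) (+) ((d == i) || (d == j))) == be))
      (+) (~~ al && ~~ be).
  by move=> iA jA; rewrite /local_graph x_in par ?subUset ?sub1set ?iA // !inE.
have [aA bA cA dA] : [/\ a \in A, b \in A, c \in A & d \in A].
  by rewrite AE !inE !eqxx !orbT.
have perm2 : uniq [:: a; c; b; d].
  by move: Us; rewrite /= !inE (eq_sym c b); do 6 case: (_ == _).
have perm3 : uniq [:: c; d; a; b].
  by move: Us; rewrite /= !inE !(eq_sym c) !(eq_sym d); do 6 case: (_ == _).
move: (Us); rewrite /= !inE !negb_or -!andbA => /and5P[ab ac ad bc /and3P[bd cd _]].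
have neq := (negPf ab, negPf ac, negPf ad, negPf bc, negPf bd, negPf cd).
have nsym (i j : 'I_n) : i != j -> (j == i) = false by rewrite eq_sym => /negPf.
have neq' := (nsym _ _ ab, nsym _ _ ac, nsym _ _ ad, nsym _ _ bc,
              nsym _ _ bd, nsym _ _ cd).
have [alE|alE] := boolP (al == be).
  exists a, c, b, d; split=> //.
    by rewrite AE; apply/setP => i; rewrite !inE;
      case: (i == a); case: (i == b); case: (i == c); case: (i == d).
  rewrite !inE !par1 // !par2 // !eqxx !neq !neq' -(eqP alE).
  by case: (al).
clear par x_in; case: al par1 par2 alE => par1 par2.
  case: be par1 par2 => // par1 par2 _.
  by exists a, b, c, d; split=> //; rewrite !inE !par1 // !par2 // !eqxx !neq !neq'.
case: be par1 par2 => // par1 par2 _.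
exists c, d, a, b; split=> //.
    by rewrite AE; apply/setP => i; rewrite !inE;
      case: (i == a); case: (i == b); case: (i == c); case: (i == d).
by rewrite !inE !par1 // !par2 // !eqxx !neq !neq'.
Qed.
End LocalStructure.

(** * The bound at a vertex *)

Definition set4 (T : finType) (t : T * T * T * T) : {set T} :=
  let: (a, b, c, d) := t in [set a; b; c; d].

Lemma card_orderings (T : finType) (k : nat) (F : {set {set T}})
    (X : {set T * T * T * T}) :
  (forall A, A \in F -> exists s : seq (T * T * T * T),
     [/\ size s = k, uniq s & {subset s <= [set t in X | set4 t == A]}]) ->
  k * #|F| <= #|X|.
Proof.
move=> FX; apply: (@leq_trans #|[set t in X | set4 t \in F]|); last first.
  by apply/subset_leq_card/subsetP => t; rewrite inE => /andP[].
rewrite -[X in _ <= X]sum1_card (partition_big (@set4 T) (mem F)) /=; last first.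
  by move=> t; rewrite inE => /andP[].
rewrite mulnC -sum_nat_const; apply: leq_sum => A AF.
have [s [<- /card_uniqP <- sX]] := FX A AF.
rewrite sum1dep_card; apply/subset_leq_card/subsetP => t /sX.
by rewrite !inE => /andP[-> /eqP->]; rewrite AF eqxx.
Qed.

Section CardSpanned.
Variables (T : finType) (V : {set T}) (e : rel T).
Hypothesis e_sym : symmetric e.

Definition spanned (X : {set T * T * T * T}) : {set {set T}} :=
  [set A | [exists t in X, let: (a, b, c, d) := t in
     uniq [:: a; b; c; d] && (A == set4 t)]].

Lemma spannedP (X : {set T * T * T * T}) (A : {set T}) :
  reflect (exists a b c d, [/\ uniq [:: a; b; c; d], A = [set a; b; c; d] &
             (a, b, c, d) \in X])
          (A \in spanned X).
Proof.
rewrite inE; apply: (iffP existsP) => [[[[[a b] c] d]] /andP[tX /andP[Us /eqP AE]]|].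
  by exists a, b, c, d.
by move=> [a [b [c [d [Us AE tX]]]]]; exists (a, b, c, d); rewrite tX Us AE eqxx.
Qed.

Lemma card_spanned_C4s :
  8 * #|spanned (induced_C4s V e)| <= #|induced_C4s V e|.
Proof.
apply: card_orderings => A /spannedP[a [b [c [d [Us -> tX]]]]].
(* The dihedral group of order 8 acts on the cyclic orderings. *)
exists [:: (a, b, c, d); (b, c, d, a); (c, d, a, b); (d, a, b, c);
           (d, c, b, a); (c, b, a, d); (b, a, d, c); (a, d, c, b)].
split=> //.
  move: Us; rewrite /= !inE !negb_or -!andbA => /and5P[ab ac ad bc /and3P[bd cd _]].
  by rewrite !xpair_eqE !(eq_sym d) !(eq_sym c a) !(eq_sym c b) (eq_sym b a)
       (negPf ab) (negPf ac) (negPf ad) (negPf bc) (negPf bd) (negPf cd) !andbF.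
move: (tX); rewrite inE => /and4P[/and4P[aV bV cV dV] /and4P[ab bc cd da] ac bd].
have ba : e b a by rewrite e_sym.
have cb : e c b by rewrite e_sym.
have dc : e d c by rewrite e_sym.
have ad : e a d by rewrite e_sym.
have ca : ~~ e c a by rewrite e_sym.
have db : ~~ e d b by rewrite e_sym.
have tP t' : t' \in induced_C4s V e -> set4 t' =i [set a; b; c; d] ->
   t' \in [set t in induced_C4s V e | set4 t == [set a; b; c; d]].
  by move=> t1X /setP t12; rewrite inE t1X t12 eqxx.
move=> t; rewrite !in_cons in_nil orbF.
by do ![case/orP] => /eqP->; apply: tP; rewrite ?inE ?aV ?bV ?cV ?dV ?ab ?bc ?cd ?da
  ?ba ?cb ?dc ?ad ?ac ?bd ?ca ?db // => i; rewrite !inE;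
  case: (i == a); case: (i == b); case: (i == c); case: (i == d).
Qed.

Lemma card_spanned_mixed :
  4 * #|spanned (mixed_pairs V e)| <= #|mixed_pairs V e|.
Proof.
apply: card_orderings => A /spannedP[a [b [c [d [Us -> tX]]]]].
exists [:: (a, b, c, d); (b, a, c, d); (a, b, d, c); (b, a, d, c)].
split=> //.
  move: Us; rewrite /= !inE !negb_or -!andbA => /and5P[ab ac ad bc /and3P[bd cd _]].
  by rewrite !xpair_eqE !(eq_sym d) (eq_sym b a)
       (negPf ab) (negPf cd) !andbF.
move: (tX); rewrite inE => /and5P[aV bV cV dV cd].
have dc : ~~ e d c by rewrite e_sym.
have tP t' : t' \in mixed_pairs V e -> set4 t' =i [set a; b; c; d] ->
   t' \in [set t in mixed_pairs V e | set4 t == [set a; b; c; d]].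
  by move=> t1X /setP t12; rewrite inE t1X t12 eqxx.
move=> t; rewrite !in_cons in_nil orbF.
by do ![case/orP] => /eqP->; apply: tP;
  rewrite ?inE ?aV ?bV ?cV ?dV ?cd ?dc // => i; rewrite !inE;
  case: (i == a); case: (i == b); case: (i == c); case: (i == d).
Qed.

(** The weight of [v] is [4 (m - d_v) (m d_v + 4 k^2)], so that [m] times it is
    bounded by [local_inequality]. *)
Lemma card_spanned_le :
  64 * (#|spanned (induced_C4s V e)| + #|spanned (mixed_pairs V e)|) <= #|T| ^ 4.
Proof.
have h1 := card_spanned_C4s; have h2 := card_spanned_mixed.
have h3 := card_induced_C4s V e_sym; rewrite card_mixed_pairs in h2.
pose weight v := 4 * #|V| * (degree V e v * nondegree V e v) +
  16 * (#|~: V| ^ 2 * nondegree V e v).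
apply: (@leq_trans (\sum_(v in V) weight v)).
  rewrite /weight big_split /= -!big_distrr /=.
  move: h1 h2 h3; rewrite -mulnn.
  move: (\sum_(v in V) nondegree V e v) (\sum_(v in V) _) => c dc.
  move: #|spanned _| #|spanned _| #|induced_C4s _ _| #|~: V| #|V| => p q N k m.
  rewrite -!mulnA; lia.
have [->|Vn0] := eqVneq V set0; first by rewrite big_set0.
rewrite -(@leq_pmul2l #|V|) ?card_gt0 // -[X in _ <= X]sum_nat_const big_distrr /=.
apply: leq_sum => v _; rewrite -(cardsC V).
have VE := degreeD V e v.
have := @local_inequality #|V| #|~: V| (degree V e v) _.
rewrite -{1}VE leq_addr => /(_ isT).
have -> : #|V| - degree V e v = nondegree V e v by rewrite -VE addKn.
by apply: leq_trans; rewrite leq_eqVlt /weight; apply/orP; left; apply/eqP; ring.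
Qed.
End CardSpanned.

Lemma card_good_sets n (S : configuration n) (x : vertex n) :
  64 * #|good_sets S x| <= n ^ 4.
Proof.
have := card_spanned_le (non_neighbours S x) (local_graph_sym S x).
rewrite card_ord; apply: leq_trans; rewrite leq_mul2l /=.
apply: leq_trans (leq_card_setU _ _); apply/subset_leq_card/subsetP => A.
move=> /good_cases[a [b [c [d [Us AE]]]]]; rewrite in_setU => /orP[] tX.
  by apply/setUP; left; apply/spannedP; exists a, b, c, d.
by apply/setUP; right; apply/spannedP; exists a, b, c, d.
Qed.

Lemma card_Y_subcubes_le n (S : configuration n) :
  1024 * #|[set R in subcubes 4 n | exact_copy Y (subcube_trace 4 S R)]| <=
    2 ^ n * n ^ 4.
Proof.
have := incidence_count 4
  (fun R : {set 'I_n} * vertex n => exact_copy Y (subcube_trace 4 S R)).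
move: #|_| => N NE.
have : \sum_(x : vertex n) 64 * #|good_sets S x| <= \sum_(x : vertex n) n ^ 4.
  by apply: leq_sum => x _; exact: card_good_sets.
rewrite -big_distrr sum_nat_const /= NE card_tuple card_bool.
by rewrite mulnA.
Qed.

(** * The parity construction *)

Lemma translation_automorphism n (D : {set 'I_n}) :
  exists2 s : {perm vertex n}, cube_automorphism s & forall u, s u = flip u D.
Proof.
have inv : involutive (fun u => flip u D).
  by move=> u; apply: eq_from_tnth => i; rewrite !tnth_flip addbK.
exists (perm (inv_inj inv)) => [|u]; last by rewrite permE.
apply/forallP => u; apply/forallP => v; rewrite !permE /cube_adjacent.
suff -> : [set i | tnth (flip u D) i != tnth (flip v D) i] =
          [set i | tnth u i != tnth v i] by [].
apply/setP => i; rewrite !inE !tnth_flip.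
by case: (tnth u i); case: (tnth v i); case: (i \in D).
Qed.

Notation o0 := (@Ordinal 4 0 isT).
Notation o1 := (@Ordinal 4 1 isT).
Notation o2 := (@Ordinal 4 2 isT).
Notation o3 := (@Ordinal 4 3 isT).

Lemma parity_exact_copy_Y (H : configuration 4) al be :
  (forall u, (u \in H) =
    (tnth u o0 (+) tnth u o1 == al) && (tnth u o2 (+) tnth u o3 == be)) ->
  exact_copy Y H.
Proof.
move=> HP; pose D := [set i | (i == o0) && al || (i == o2) && be].
have [s sP sE] := translation_automorphism D.
apply/existsP; exists s; rewrite sP eqEsubset /=.
have inY u : u \in Y = (tnth u o0 == tnth u o1) && (tnth u o2 == tnth u o3).
  rewrite /Y !inE !(@eq_vertex4 o0 o1 o2 o3) // !(tnth_nth false) /=.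
  by do 4 case: (nth false u _).
have fl u : s (s u) = u.
  by rewrite !sE; apply: eq_from_tnth => i; rewrite !tnth_flip addbK.
have HY u : (s u \in H) = (u \in Y).
  rewrite HP inY sE !tnth_flip !inE /=.
  by case: (tnth u o0); case: (tnth u o1); case: (tnth u o2);
    case: (tnth u o3); case: (al); case: (be).
apply/andP; split; apply/subsetP => u.
  by case/imsetP => v vY ->; rewrite HY.
by move=> uH; apply/imsetP; exists (s u); rewrite ?fl // -HY fl.
Qed.

Section EvenHalves.
Variables (n h : nat).

Definition low : {set 'I_n} := [set i : 'I_n | i < h].
Definition parity (L : {set 'I_n}) (x : vertex n) : bool :=
  \big[addb/false]_(i in L) tnth x i.
Definition even_halves : configuration n :=
  [set x | ~~ parity low x & ~~ parity (~: low) x].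

Lemma parity_flip L x D :
  parity L (flip x D) = parity L x (+) \big[addb/false]_(i in L) (i \in D).
Proof.
by rewrite /parity -big_split /=; apply: eq_bigr => i _; rewrite tnth_flip.
Qed.

Lemma sorted_enum_ord (A : {set 'I_n}) : sorted ltn (map val (enum A)).
Proof.
apply: (@subseq_sorted _ ltn ltn_trans _ (iota 0 n)); last exact: iota_ltn_sorted.
by rewrite -val_enum_ord map_subseq // enumT; exact: filter_subseq.
Qed.

(** Directions are listed in increasing order, so the first two are below [h] and
    the last two are not: the trace is given by parity conditions on the
    coordinates 0, 1 and 2, 3, and it is a translate of [Y]. *)
Lemma balanced_exact_copy (A : {set 'I_n}) x : #|A| = 4 -> #|A :&: low| = 2 ->
  exact_copy Y (subcube_trace 4 even_halves (A, clear A x)).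
Proof.
move=> A4 Al; have := sorted_enum_ord A; have := cardE A; rewrite A4.
have AlE : #|A :&: low| = \sum_(i <- enum A) (i < h).
  rewrite big_enum -sum1_card big_mkcond [RHS]big_mkcond; apply: eq_bigr => i _.
  by rewrite !inE; case: (i \in A) => //=; case: (i < h).
case eE: (enum A) AlE => [|e0 [|e1 [|e2 [|e3 []]]]] //=.
rewrite Al !big_cons big_nil => lowE _ /and4P[e01 e12 e23 _].
pose e := [tuple e0; e1; e2; e3].
have eA : e = enum A :> seq _ by rewrite eE.
have [l0 l1 l2 l3] : [/\ e0 < h, e1 < h, h <= e2 & h <= e3].
  move: lowE; rewrite [h <= e2]leqNgt [h <= e3]leqNgt.
  have [h0|h0] := ltnP e0 h; have [h1|h1] := ltnP e1 h;
  have [h2|h2] := ltnP e2 h; have [h3|h3] := ltnP e3 h => //; lia.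
have neq01 : e0 != e1 by rewrite -val_eqE neq_ltn e01.
have neq23 : e2 != e3 by rewrite -val_eqE neq_ltn e23.
have inA i : (i \in A) = [|| i == e0, i == e1, i == e2 | i == e3].
  by rewrite -mem_enum eE !inE.
have lowP : A :&: low = [set e0; e1].
  apply/setP => i; rewrite !inE inA.
  have [->|_] := eqVneq i e0; first by rewrite l0.
  have [->|_] := eqVneq i e1; first by rewrite l1.
  have [->|_] := eqVneq i e2; first by rewrite ltnNge l2.
  by have [->|_] := eqVneq i e3; rewrite ?andbF // ltnNge l3.
have hiP : A :&: ~: low = [set e2; e3].
  apply/setP => i; rewrite !inE inA -leqNgt.
  have [->|_] := eqVneq i e2; first by rewrite l2 !orbT.
  have [->|_] := eqVneq i e3; first by rewrite l3 !orbT.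
  have [->|_] := eqVneq i e0; first by rewrite leqNgt l0.
  by have [->|_] := eqVneq i e1; rewrite ?andbF // leqNgt l1.
pose y := clear A x.
apply: (@parity_exact_copy_Y _ (parity low y) (parity (~: low) y)) => u.
pose D := [set i in A | tnth (subcube_embed (A, y) u) i].
have embE : subcube_embed (A, y) u = flip y D.
  apply: eq_from_tnth => i; rewrite tnth_flip inE.
  have [iA|iA] := boolP (i \in A); last first.
    by rewrite /= addbF tnth_mktuple /= (negPf iA).
  by rewrite [tnth y i]tnth_mktuple iA.
have parD (L : {set _}) :
    \big[addb/false]_(i in L) (i \in D) = \big[addb/false]_(i in A :&: L) (i \in D).
  rewrite big_mkcond [RHS]big_mkcond; apply: eq_bigr => i _; rewrite !inE.
  by case: (i \in A); case: (i \in L).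
have inD k : (tnth e k \in D) = tnth u k.
  by rewrite inE tnth_subcube_embed // -mem_enum -eA mem_tnth.
rewrite in_set embE in_set (parity_flip low y D) (parity_flip (~: low) y D).
rewrite (parD low) (parD (~: low)) lowP hiP.
rewrite !(big_setU1, big_set1) ?in_set1 //.
rewrite -(inD o0) -(inD o1) -(inD o2) -(inD o3) !(tnth_nth e0) /=.
by case: (parity _ _); case: (parity _ _); case: (_ \in _); case: (_ \in _);
  case: (_ \in _); case: (_ \in _).
Qed.

Lemma card_balanced : h <= n ->
  'C(h, 2) * 'C(n - h, 2) <=
  #|[set A : {set 'I_n} | (#|A| == 4) && (#|A :&: low| == 2)]|.
Proof.
move=> hn.
have lowE : #|low| = h.
  by rewrite -sum1dep_card -(big_ord_widen n (fun=> 1) hn) sum1_card card_ord.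
have hiE : #|~: low| = n - h by have := cardsC low; rewrite lowE card_ord; lia.
rewrite -{1}lowE -hiE -!cards_draws -cardsX.
have disj (B C : {set 'I_n}) : B \subset low -> C \subset ~: low ->
    ((B :|: C) :&: low = B) * ((B :|: C) :&: ~: low = C).
  move=> Bl Cl; split; apply/setP => i;
    have := introT implyP (subsetP Bl i); have := introT implyP (subsetP Cl i);
    by rewrite !inE; case: (i < h); case: (i \in B); case: (i \in C).
rewrite -(@card_in_imset _ _ (fun p => p.1 :|: p.2)); last first.
  move=> [B C] [B' C']; rewrite !inE /=.
  move=> /andP[/andP[Bl _] /andP[Cl _]] /andP[/andP[Bl' _] /andP[Cl' _]] E.
  have := disj _ _ Bl Cl; rewrite E (disj _ _ Bl' Cl').1 (disj _ _ Bl' Cl').2.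
  by move=> [-> ->].
apply/subset_leq_card/subsetP => A /imsetP[[B C]]; rewrite !inE /=.
move=> /andP[/andP[Bl /eqP B2] /andP[Cl /eqP C2]] ->.
by rewrite -(cardsID low (B :|: C)) setDE !(disj _ _ Bl Cl) B2 C2.
Qed.

Lemma card_Y_subcubes_ge : h <= n ->
  2 ^ n * ('C(h, 2) * 'C(n - h, 2)) <=
  16 * #|[set R in subcubes 4 n | exact_copy Y (subcube_trace 4 even_halves R)]|.
Proof.
move=> hn; rewrite -(incidence_count 4 (fun R : {set 'I_n} * vertex n =>
  exact_copy Y (subcube_trace 4 even_halves R))).
rewrite -[2 ^ n](_ : #|{: vertex n}| = _); last by rewrite card_tuple card_bool.
rewrite -sum_nat_const; apply: leq_sum => x _.
apply: leq_trans (card_balanced hn) _; apply/subset_leq_card/subsetP => A.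
by rewrite !inE => /andP[/eqP A4 /eqP l2]; rewrite A4 balanced_exact_copy.
Qed.

End EvenHalves.

(** * The limit *)

Lemma bin4 n : 24 * 'C(n.+4, 4) = n.+4 * n.+3 * n.+2 * n.+1.
Proof. by have := bin_ffact n.+4 4; rewrite !ffactnS ffactn0 !factS fact0 /=; lia. Qed.

Lemma balanced_bin n : 3 * 'C(n.+4, 4) <= 8 * ('C(n.+4./2, 2) * 'C(n.+4 - n.+4./2, 2)).
Proof.
have b2 m : 2 * 'C(m, 2) = m * m.-1.
  rewrite bin2 mul2n -[RHS]odd_double_half oddM; case: m => // m.
  by rewrite /= andNb.
have b4 := bin4 n; have ea := b2 (n.+4./2); have eb := b2 (n.+4 - n.+4./2).
suff : n.+4 * n.+3 * n.+2 * n.+1 <=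
    16 * (n.+4./2 * n.+4./2.-1) * ((n.+4 - n.+4./2) * (n.+4 - n.+4./2).-1).
  rewrite -ea -eb -b4; move: {ea eb b4} ('C(n.+4, 4)) ('C(n.+4 ./2, 2))
    ('C(n.+4 - n.+4 ./2, 2)) => c a b; lia.
have := odd_double_half n.+4; move: n.+4./2 => a; case: (odd n.+4) => na.
  have [b [n1E aE]] : exists b, n.+1 = 2 * b /\ a = b.+1 by exists a.-1; lia.
  have -> : n.+4 - a = b.+2 by lia.
  rewrite aE n1E /=.
  have -> : 16 * (b.+1 * b) * (b.+2 * b.+1) =
    (2 * b).+3 * (2 * b).+2 * (2 * b).+1 * (2 * b) + 4 * b * b.+1 * (4 * b + 5) by ring.
  exact: leq_addr.
have [b [nE aE]] : exists b, n = 2 * b /\ a = b.+2 by exists a.-2; lia.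
have -> : n.+4 - a = b.+2 by lia.
rewrite aE nE /=.
have -> : 16 * (b.+2 * b.+1) * (b.+2 * b.+1) =
  (2 * b).+4 * (2 * b).+3 * (2 * b).+2 * (2 * b).+1 +
  4 * b.+1 * b.+2 * (4 * b + 5) by ring.
exact: leq_addr.
Qed.

From mathcomp Require Import classical_sets reals topology normedtype sequences.
Import Order.TTheory GRing.Theory Num.Theory.
Import numFieldNormedType.Exports.
Local Open Scope ring_scope.

Section Density.
Variable K : realType.

Lemma max_copy_fraction_ge n : 3%:R / 8%:R <= max_copy_fraction K Y n.+4.
Proof.
apply: le_trans (le_bigmax _ _ (@even_halves n.+4 n.+4./2)).
rewrite /copy_fraction.
have le_h : (n.+4./2 <= n.+4)%N by lia.
have := card_Y_subcubes_ge le_h; have := balanced_bin n.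
set N := #|_|; set C := ('C(n.+4./2, 2) * _)%N => CC NC.
have den : (0 < 'C(n.+4, 4) * 2 ^ (n.+4 - 4))%N.
  by rewrite muln_gt0 bin_gt0 expn_gt0.
rewrite ler_pdivlMr ?ltr0n // mulrAC ler_pdivrMr ?ltr0n // -!natrM ler_nat.
have -> : (n.+4 - 4 = n)%N by rewrite -addn4 addnK.
have {}NC : (2 ^ n * C <= N)%N by move: NC; rewrite !expnS; lia.
by have := leq_mul (leqnn (2 ^ n)%N) CC; lia.
Qed.

(** With [N = n + 4], the counting bound is 3/8 times
    [N^3 / ((N - 1) (N - 2) (N - 3))], at most the cube of
    [N / (N - 3) = 1 + 3 / (n + 1)]. *)
Lemma max_copy_fraction_le n :
  max_copy_fraction K Y n.+4 <= 3%:R / 8%:R * (1 + 3%:R * harmonic n) ^+ 3.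
Proof.
apply: bigmax_le => [|S _].
  by rewrite mulr_ge0 ?divr_ge0 // exprn_ge0 // addr_ge0 // mulr_ge0 // invr_ge0.
rewrite /copy_fraction.
have := card_Y_subcubes_le S; set N := #|_| => NC.
have den : (0 < 'C(n.+4, 4) * 2 ^ (n.+4 - 4))%N.
  by rewrite muln_gt0 bin_gt0 expn_gt0.
rewrite ler_pdivrMr ?ltr0n //.
have -> : 1 + 3%:R * harmonic n = n.+4%:R / n.+1%:R :> K.
  have n1 : n.+1%:R != 0 :> K by rewrite pnatr_eq0.
  rewrite -[X in X + _](divff n1) -mulrDl; congr (_ / _).
  by rewrite -natrD; congr (_%:R); lia.
have -> (p q r : K) :
    3%:R / 8%:R * (p / q) ^+ 3 * r = 3%:R * p ^+ 3 * r / (8%:R * q ^+ 3).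
  by rewrite expr_div_n [in RHS]invfM; ring.
rewrite ler_pdivlMr ?mulr_gt0 ?exprn_gt0 ?ltr0n //.
rewrite -!natrX -!natrM ler_nat.
have := bin4 n; move: NC den; rewrite -[in (n.+4 - 4)%N]addn4 addnK.
rewrite -[in (2 ^ n.+4)%N]addn4 expnD => NC _ CE.
have {}NC : (64 * N <= 2 ^ n * n.+4 ^ 4)%N by lia.
rewrite -(@leq_pmul2l 8) //.
apply: (@leq_trans (2 ^ n * n.+4 ^ 4 * n.+1 ^ 3)%N).
  by have := leq_mul NC (leqnn (n.+1 ^ 3)%N); lia.
apply: (@leq_trans (2 ^ n * n.+4 ^ 3 * (24 * 'C(n.+4, 4)))%N); last by lia.
have sq : (n.+1 * n.+1 <= n.+3 * n.+2)%N by apply: leq_mul; lia.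
rewrite CE; have := leq_mul (leqnn (2 ^ n * n.+4 ^ 4 * n.+1)%N) sq.
by rewrite !expnS !expn0; move: n.+4 n.+3 n.+2 n.+1 (2 ^ n)%N => a b c d p; lia.
Qed.
End Density.

Theorem theorem8p1 (K : realType) :
  cvgn (max_copy_fraction K Y) /\ cube_density K Y = 3%:R / 8%:R.
Proof.
suff lim : (max_copy_fraction K Y @ \oo --> (3%:R / 8%:R : K))%classic.
  by split; [apply/cvg_ex; exists (3%:R / 8%:R) | exact: cvg_lim].
rewrite -(cvg_shiftn 4).
apply: (squeeze_cvgr (f := fun=> 3%:R / 8%:R)
   (h := fun n => 3%:R / 8%:R * (1 + 3%:R * harmonic n) ^+ 3)).
- by near=> n; rewrite /= addn4 max_copy_fraction_ge max_copy_fraction_le.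
- exact: cvg_cst.
have lim1 : ((1 + 3%:R * harmonic n) @[n --> \oo] --> (1 + 3%:R * 0 : K))%classic.
  apply: cvgD; first exact: cvg_cst.
  by apply: cvgM; [exact: cvg_cst | exact: cvg_harmonic].
have lim3 := cvgM (cvg_cst (3%:R / 8%:R : K)) (cvgM lim1 (cvgM lim1 lim1)).
by rewrite mulr0 addr0 !mulr1 in lim3; exact: lim3.
Unshelve. all: by end_near.
Qed.
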